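(* Let $G$ be an affine game. Then $G\geqslant 0$ if and only if $G\in\mathcal L\cup\mathcal P$.
   Context: Affine games are defined recursively. There are two games without options, denoted $\infty$ and $\overline{\infty}$ (terminating games). Every other affine game is a form $G=\{G^{\mathcal L}\mid G^{\mathcal R}\}$, where $G^{\mathcal L}$ (Left options) and $G^{\mathcal R}$ (Right options) are non-empty finite sets of previously constructed affine games. Let $\mathbb A$ be the set of all affine games. The game $0$ is $\{\overline\infty\mid\infty\}$. Disjunctive sum: $G+H$ is undefined if one of $G,H$ is the form $\infty$ and the other is $\overline\infty$; it is $\infty$ if one is $\infty$ and the other is not $\overline\infty$; it is $\overline\infty$ if one is $\overline\infty$ and the other is not $\infty$; otherwise $G+H=\{G^{\mathcal L}+H,\,G+H^{\mathcal L}\mid G^{\mathcal R}+H,\,G+H^{\mathcal R}\}$. Outcomes: $o^L(G)=\mathbf L$ if $G=\infty$ or some $G^L\in G^{\mathcal L}$ has $o^R(G^L)=\mathbf L$, and $o^L(G)=\mathbf R$ otherwise; $o^R(G)=\mathbf R$ if $G=\overline\infty$ or some $G^R\in G^{\mathcal R}$ has $o^L(G^R)=\mathbf R$, and $o^R(G)=\mathbf L$ otherwise. With $\mathbf L>\mathbf R$, the outcome is $o(G)=(o^L(G),o^R(G))$, ordered componentwise. $\mathcal L,\mathcal N,\mathcal P,\mathcal R$ are the classes of games with outcome $(\mathbf L,\mathbf L)$, $(\mathbf L,\mathbf R)$, $(\mathbf R,\mathbf L)$, $(\mathbf R,\mathbf R)$, respectively. Order: $G\geqslant H$ iff $o(G+X)\geqslant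 o(H+X)$ for all $X\in\mathbb A\setminus\{\infty,\overline\infty\}$. *)

(* Defs.v *)
From mathcomp Require Import all_boot.

Set Implicit Arguments.
Unset Strict Implicit.
Unset Printing Implicit Defensive.

(* The finite sets of options are presented by lists; sums, outcomes and the
   order only depend on which forms occur in them, not on the order of
   enumeration or on repetitions. *)
Inductive form : Type :=
| Inf
| InfBar
| Node of seq form & seq form.

Definition nonempty (T : Type) (s : seq T) : bool := ~~ nilp s.

Fixpoint affine (G : form) : bool :=
  match G with
  | Inf | InfBar => true
  | Node GL GR => [&& nonempty GL, nonempty GR, all affine GL & all affine GR]
  end.

Definition terminating (G : form) : bool :=
  if G is Node _ _ then false else true.

Definition zero : form := Node [:: InfBar] [:: Inf].

(* [None] means undefined.  Using [pmap] discards no option: in each recursive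
   call at least one summand is a [Node], so the result is defined, see
   [add_eq_None]. *)
Fixpoint add (G : form) : form -> option form :=
  fix addG (H : form) : option form :=
    match G, H with
    | Inf, InfBar | InfBar, Inf => None
    | Inf, _ | _, Inf => Some Inf
    | InfBar, _ | _, InfBar => Some InfBar
    | Node GL GR, Node HL HR =>
        Some (Node (pmap (fun g => add g H) GL ++ pmap addG HL)
                   (pmap (fun g => add g H) GR ++ pmap addG HR))
    end.

Lemma add_eq_None (G H : form) :
  add G H = None <-> (G = Inf /\ H = InfBar) \/ (G = InfBar /\ H = Inf).
Proof.
split; last by case=> -[-> ->].
by case: G => [||GL GR]; case: H => [||HL HR] //= _; [left | right].
Qed.

Inductive player : Type := PLeft | PRight.

Definition is_left (p : player) : bool := if p is PLeft then true else false.
Definition is_right (p : player) : bool := if p is PRight then true else false.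

Fixpoint outL (G : form) : player :=
  match G with
  | Inf => PLeft
  | InfBar => PRight
  | Node GL _ => if has (fun g => is_left (outR g)) GL then PLeft else PRight
  end
with outR (G : form) : player :=
  match G with
  | Inf => PLeft
  | InfBar => PRight
  | Node _ GR => if has (fun g => is_right (outL g)) GR then PRight else PLeft
  end.

Definition outcome (G : form) : player * player := (outL G, outR G).

(* [PRight] is below [PLeft]. *)
Definition player_le (p q : player) : bool := is_right p || is_left q.

Definition outcome_le (o o' : player * player) : bool :=
  player_le o.1 o'.1 && player_le o.2 o'.2.

Definition classL (G : form) : Prop := outcome G = (PLeft, PLeft).
Definition classN (G : form) : Prop := outcome G = (PLeft, PRight).
Definition classP (G : form) : Prop := outcome G = (PRight, PLeft).
Definition classR (G : form) : Prop := outcome G = (PRight, PRight).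

(* Both sums are always defined, since [X] is not terminating. *)
Definition game_ge (G H : form) : Prop :=
  forall X : form, affine X -> ~~ terminating X ->
    exists GX HX : form,
      [/\ add G X = Some GX, add H X = Some HX
        & outcome_le (outcome HX) (outcome GX)].

(* Main.v *)
Require Import Defs.
From mathcomp Require Import all_boot.
From Stdlib Require List.

(** Both [G >= 0] and membership in the two classes amount to Left winning [G]
    when Right starts.  Adding [0] never changes an outcome, since a player who
    moves in [0] loses at once; testing [G >= 0] against [X = 0] gives one
    direction.  Conversely, if Left wins [G] moving second, she wins [G + X]
    whenever she wins [X], by answering each move of Right in the summand where
    it was made. *)

(** Options are nested inside [seq], so the generated principle carries no hypothesis about them.
    Membership is [List.In] because [form] has no [eqType] structure here. *)
Lemma form_nested_ind (P : form -> Prop) :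
  P Inf -> P InfBar ->
  (forall GL GR, (forall g, List.In g GL -> P g) ->
     (forall g, List.In g GR -> P g) -> P (Node GL GR)) ->
  forall G, P G.
Proof.
move=> PInf PInfBar PNode; fix IH 1; case=> [||GL GR]; [exact: PInf | exact: PInfBar |].
apply: PNode.
- elim: GL => [g []|g s IHs h [<-|]]; [exact: IH | exact: IHs].
- elim: GR => [g []|g s IHs h [<-|]]; [exact: IH | exact: IHs].
Qed.

Section Sequences.

Variables T U : Type.

Lemma has_InP (p : pred T) (s : seq T) :
  reflect (exists2 x, List.In x s & p x) (has p s).
Proof.
apply: (iffP idP) => [|[x]]; elim: s => //= y s IHs.
- by case/orP=> [py|/IHs[x xs px]]; [exists y; first left | exists x; first right].
- by case=> [-> ->|xs px] //; rewrite (IHs xs px) orbT.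
Qed.

Lemma all_InP (p : pred T) (s : seq T) :
  reflect (forall x, List.In x s -> p x) (all p s).
Proof.
apply: (iffP idP) => [|]; elim: s => //= y s IHs.
- by case/andP=> py /IHs ps x [<-|/ps].
- by move=> ps; rewrite ps ?IHs //; [move=> x xs; apply: ps; right | left].
Qed.

Lemma eq_has_In (p q : pred T) (s : seq T) :
  (forall x, List.In x s -> p x = q x) -> has p s = has q s.
Proof.
elim: s => //= y s IHs pq; rewrite pq ?IHs //; last by left.
by move=> x xs; apply: pq; right.
Qed.

(** Entries sent to [None] are dropped, so they must count as [false] for [has] and, in [all_pmap],
    as [true]. *)
Lemma has_pmap (p : pred U) (f : T -> option U) (s : seq T) :
  has p (pmap f s) = has (fun x => oapp p false (f x)) s.
Proof. by elim: s => //= x s <-; case: (f x). Qed.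

Lemma all_pmap (p : pred U) (f : T -> option U) (s : seq T) :
  all p (pmap f s) = all (fun x => oapp p true (f x)) s.
Proof. by elim: s => //= x s <-; case: (f x). Qed.

End Sequences.

Lemma add_Node (GL GR HL HR : seq form) :
  add (Node GL GR) (Node HL HR) =
    Some (Node
      (pmap (add^~ (Node HL HR)) GL ++ pmap (add (Node GL GR)) HL)
      (pmap (add^~ (Node HL HR)) GR ++ pmap (add (Node GL GR)) HR)).
Proof. by []. Qed.

Lemma outcome_Node (GL GR : seq form) :
  outcome (Node GL GR) =
    (if has (fun g => Defs.is_left (outR g)) GL then PLeft else PRight,
     if has (fun g => Defs.is_right (outL g)) GR then PRight else PLeft).
Proof. by []. Qed.

Lemma add_zero_outcome (X : form) :
  exists2 S, add zero X = Some S & outcome S = outcome X.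
Proof.
elim/form_nested_ind: X => [||XL XR IHL IHR]; [by exists Inf | by exists InfBar |].
rewrite /zero add_Node; eexists; first by [].
(* The move in [zero] leads to [InfBar] for Left and to [Inf] for Right, so its test evaluates to
   [false] and only the moves in [X] remain. *)
rewrite !outcome_Node !has_cat !has_pmap ![has _ [:: _]]/= !orFb.
congr (if _ then _ else _, if _ then _ else _); apply: eq_has_In => x.
- by case/IHL=> S -> [_ /= ->].
- by case/IHR=> S -> [/= -> _].
Qed.

Lemma outcome_add_zero (X : form) :
  exists2 S, add X zero = Some S & outcome S = outcome X.
Proof.
elim/form_nested_ind: X => [||XL XR IHL IHR]; [by exists Inf | by exists InfBar |].
rewrite /zero add_Node; eexists; first by [].
rewrite !outcome_Node !has_cat !has_pmap ![has _ [:: _]]/= !orbF.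
congr (if _ then _ else _, if _ then _ else _); apply: eq_has_In => x.
- by case/IHL=> S -> [_ /= ->].
- by case/IHR=> S -> [/= -> _].
Qed.

Definition left_wins_first (G : form) : bool := Defs.is_left (outL G).
Definition left_wins_second (G : form) : bool := Defs.is_left (outR G).

Lemma left_wins_first_Node (GL GR : seq form) :
  left_wins_first (Node GL GR) = has left_wins_second GL.
Proof. by rewrite /left_wins_first /=; case: has. Qed.

Lemma left_wins_second_Node (GL GR : seq form) :
  left_wins_second (Node GL GR) = all left_wins_first GR.
Proof.
rewrite /left_wins_second /= -[RHS]negbK -has_predC.
rewrite (eq_has (a2 := predC left_wins_first)); first by case: has.
by move=> g; rewrite /left_wins_first /=; case: outL.
Qed.

(** The three claims need one simultaneous induction. After a move of Right in [G] or in [X], the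
    first claim falls back on the second or the third; there Left plays her winning move in the
    summand she wins moving first, which restores the first claim. The sum is defined because Left
    wins neither way in [InfBar]. *)
Lemma left_wins_add (G X : form) :
  [/\ left_wins_second G -> left_wins_second X ->
        exists2 S, add G X = Some S & left_wins_second S,
      left_wins_first G -> left_wins_second X ->
        exists2 S, add G X = Some S & left_wins_first S
    & left_wins_second G -> left_wins_first X ->
        exists2 S, add G X = Some S & left_wins_first S].
Proof.
elim/form_nested_ind: G X => [||GL GR IHGL IHGR] X.
- by case: X => [||XL XR]; split=> // _ _; exists Inf.
- by split.
(* The outer hypotheses cover moves in [G] with any second summand; this inner induction, with [G]
   fixed, covers moves in [X]. *)
elim/form_nested_ind: X => [||XL XR IHXL IHXR]; [by split=> // _ _; exists Inf | by split |].
rewrite add_Node; split=> wG wX; eexists=> //.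
- rewrite left_wins_second_Node all_cat !all_pmap.
  apply/andP; split; apply/all_InP=> x xR.
  + have [_ IH _] := IHGR x xR (Node XL XR).
    move: wG; rewrite left_wins_second_Node => /all_InP/(_ x xR) wx.
    by have [S -> wS] := IH wx wX.
  + have [_ _ IH] := IHXR x xR.
    move: wX; rewrite left_wins_second_Node => /all_InP/(_ x xR) wx.
    by have [S -> wS] := IH wG wx.
- move: wG; rewrite !left_wins_first_Node has_cat !has_pmap => /has_InP[x xL wx].
  have [IH _ _] := IHGL x xL (Node XL XR).
  apply/orP; left; apply/has_InP; exists x => //.
  by have [S -> wS] := IH wx wX.
- move: wX; rewrite !left_wins_first_Node has_cat !has_pmap => /has_InP[x xL wx].
  have [IH _ _] := IHXL x xL.
  apply/orP; right; apply/has_InP; exists x => //.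
  by have [S -> wS] := IH wG wx.
Qed.

Lemma classLP (G : form) : classL G \/ classP G <-> left_wins_second G.
Proof.
rewrite /classL /classP /outcome /left_wins_second.
by case: (outL G); case: (outR G); split=> //;
  by [left | right | case].
Qed.

Theorem theorem14 (G : form) (hG : affine G) :
  game_ge G zero <-> classL G \/ classP G.
Proof.
rewrite classLP; split=> [/(_ zero isT isT)[S [S0 [addG add0 /andP[_ le0]]]] | wG X _ ntX].
- have [S' addG' [_ eqR]] := outcome_add_zero G.
  (* Here [X] is [zero]. The sum of [zero] with itself computes to a form that Right loses moving
     first, so [le0] forces Left to win [S'] moving second. *)
  move: addG add0 le0; rewrite addG' => -[<-] [<-].
  by rewrite /= eqR.
have [S0 add0 eq0] := add_zero_outcome X.
have [IHR _ IHL] := left_wins_add G X.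
have [S addS] : exists S, add G X = Some S.
  case addGX: (add G X) => [S|]; first by exists S.
  by case/add_eq_None: addGX ntX => -[_ ->].
exists S, S0; split=> //; rewrite eq0 /outcome_le /player_le /=; apply/andP; split.
(* The comparison is only a constraint when Left wins [X]; then [left_wins_add] gives her the
   sum. *)
- case wX: (outL X) => //=.
  have [|S' ] := IHL wG; first by rewrite /left_wins_first wX.
  by rewrite addS => -[->].
- case wX: (outR X) => //=.
  have [|S' ] := IHR wG; first by rewrite /left_wins_second wX.
  by rewrite addS => -[->].
Qed.
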